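(* Let $K$ be an arbitrary field and $p\in K\langle x_1,\dots,x_m\rangle$ a multilinear polynomial evaluated on $M_2(K)$. Then $\operatorname{Im} p$ is either $\{0\}$, or the set $K$ of scalar matrices, or $\operatorname{sl}_2(K)\subseteq \operatorname{Im} p$. If $K=\mathbb{R}$, then $\operatorname{Im} p$ is exactly one of $\{0\}$, $\mathbb{R}$ (scalar matrices), $\operatorname{sl}_2(\mathbb{R})$, or $M_2(\mathbb{R})$.
   Context: A polynomial is multilinear if it has the form $\sum_{\sigma\in S_m}c_\sigma x_{\sigma(1)}\cdots x_{\sigma(m)}$. $\operatorname{Im} p=\{p(a_1,\dots,a_m):a_i\in M_2(K)\}$, and $\operatorname{sl}_2(K)$ is the set of trace-zero $2\times2$ matrices. *)

(* Defs.v *)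
From HB Require Import structures.
From mathcomp Require Import all_boot all_order all_algebra all_fingroup.
Set Implicit Arguments. Unset Strict Implicit. Unset Printing Implicit Defensive.
Import Order.TTheory GRing.Theory Num.Theory.
Local Open Scope ring_scope.

(* Evaluation of the multilinear polynomial
   p = sum_{s in S_m} c_s x_{s(0)} x_{s(1)} ... x_{s(m-1)}
   at a tuple a : 'I_m -> M_2(K).  The product is ordered by index. *)
Definition mlin_eval (K : fieldType) (m : nat) (c : {perm 'I_m} -> K)
    (a : 'I_m -> 'M[K]_2) : 'M[K]_2 :=
  \sum_(s : {perm 'I_m}) c s *: \prod_(i < m) a (s i).

Definition mlin_image (K : fieldType) (m : nat) (c : {perm 'I_m} -> K)
    (A : 'M[K]_2) : Prop :=
  exists a : 'I_m -> 'M[K]_2, mlin_eval c a = A.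

(* Main.v *)
(* Grade M_2(K) by the matrix units: on a tuple of matrix units p takes a multiple
   of e_01, a multiple of e_10, or a diagonal matrix.  If all these values are
   diagonal, conjugation invariance makes p central and Im p is {0} or K.
   Otherwise p takes a value k e_01 and, exchanging the indices 0 and 1 in the
   arguments, the value k e_10.  A multilinear map that takes two independent values
   on a product of subspaces takes two independent values at points which differ in
   one coordinate, hence all combinations of these; applied to the parity grading
   this puts every antidiagonal matrix in Im p, and nonscalar trace-zero matrices are
   similar to antidiagonal ones.  The diagonal analogue handles scalar matrices.

   Over a real closed field, when some value has nonzero trace, consider the form
   det - th tr^2 for a given th.  It takes both signs on sl_2, hence, by perturbation,
   both signs on values of nonzero trace; moving one coordinate at a time through
   generic points yields two values of opposite signs that differ in one coordinate,
   and the intermediate value theorem on the segment joining them gives a value of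
   nonzero trace with det = th tr^2. *)
Require Import Defs.
From HB Require Import structures.
From mathcomp Require Import all_boot all_order all_algebra all_fingroup.
From mathcomp Require Import ring lra.
Import Order.TTheory GRing.Theory Num.Theory.
Local Open Scope ring_scope.
Set Implicit Arguments. Unset Strict Implicit. Unset Printing Implicit Defensive.

(** * Multilinear maps *)

Definition upd (I : eqType) (V : Type) (a : I -> V) (i : I) (v : V) : I -> V :=
  fun j => if j == i then v else a j.

Lemma upd_id (I : eqType) (V : Type) (a : I -> V) i : upd a i (a i) =1 a.
Proof. by move=> j; rewrite /upd; case: eqP => [->|]. Qed.

Definition multilinear (K : fieldType) (I : eqType) (V W : lmodType K)
    (f : (I -> V) -> W) : Prop :=
  (forall a b, a =1 b -> f a = f b) /\
  (forall a i s t u v,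
     f (upd a i (s *: u + t *: v)) = s *: f (upd a i u) + t *: f (upd a i v)).

Definition lin_closed (K : fieldType) (V : lmodType K) (T : V -> Prop) : Prop :=
  T 0 /\ (forall s t u v, T u -> T v -> T (s *: u + t *: v)).

Lemma lin_closed_sum (K : fieldType) (V : lmodType K) (T : V -> Prop)
    (J : Type) (r : seq J) (P : pred J) (F : J -> V) :
  lin_closed T -> (forall j, T (F j)) -> T (\sum_(j <- r | P j) F j).
Proof.
case=> T0 TD TF; apply: big_ind => // u v Tu Tv.
by rewrite -[u]scale1r -[v]scale1r; apply: TD.
Qed.

Lemma lin_closedZ (K : fieldType) (V : lmodType K) (T : V -> Prop) k v :
  lin_closed T -> T v -> T (k *: v).
Proof. by case=> T0 TD Tv; rewrite -[_ *: _]addr0 -[0](scale0r v); apply: TD. Qed.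

(** The list [r] bounds the coordinates in which the tuples may differ; arguments that move one
    coordinate at a time induct on it. *)
Definition agree_off (I : eqType) (V : Type) (r : seq I) (x y : I -> V) : Prop :=
  forall i, i \notin r -> x i = y i.

Lemma agree_off_upd (I : eqType) (V : Type) (r : seq I) (x y : I -> V) i v :
  agree_off (i :: r) x y -> agree_off r (upd x i v) (upd y i v).
Proof.
move=> xy j jr; rewrite /upd; case: eqP => // /eqP ji.
by apply: xy; rewrite inE negb_or ji jr.
Qed.

Lemma agree_off_updl (I : eqType) (V : Type) (r : seq I) (x y : I -> V) i :
  agree_off (i :: r) x y -> agree_off r (upd x i (y i)) y.
Proof.
move=> xy j jr; rewrite /upd; case: (j =P i) => [->//|/eqP ji].
by apply: xy; rewrite inE negb_or ji jr.
Qed.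

Lemma agree_off_updr (I : eqType) (V : Type) (r : seq I) (x y : I -> V) i :
  agree_off (i :: r) x y -> agree_off r x (upd y i (x i)).
Proof.
move=> xy j jr; rewrite /upd; case: (j =P i) => [->//|/eqP ji].
by apply: xy; rewrite inE negb_or ji jr.
Qed.

Lemma cramer2 (K : fieldType) (p q r s al be : K) :
  p * s - q * r != 0 ->
  exists u v, u * p + v * r = al /\ u * q + v * s = be.
Proof.
move=> D; exists ((al * s - be * r) / (p * s - q * r)),
                 ((be * p - al * q) / (p * s - q * r)).
by split; field.
Qed.

(* If two values w and w' are independent and no pair of independent values can
   be found closer to each other, then all mixed values vanish; the diagonal
   move x_i + y_i then keeps w and w' while equalizing the coordinate i. *)
Lemma multilinear_pair_surj (K : fieldType) (I : eqType) (V : lmodType K)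
    (f g : (I -> V) -> K^o) (T : I -> V -> Prop) (r : seq I) (x y : I -> V) :
  multilinear f -> multilinear g -> (forall i, lin_closed (T i)) ->
  (forall i, T i (x i)) -> (forall i, T i (y i)) ->
  agree_off r x y -> f x * g y - g x * f y != 0 ->
  forall al be : K, exists z, (forall i, T i (z i)) /\ f z = al /\ g z = be.
Proof.
move=> [fe fl] [ge gl] Tl.
have T_upd i z v : (forall j, T j (z j)) -> T i v -> forall j, T j (upd z i v j).
  by move=> Tz Tv j; rewrite /upd; case: eqP => // ->.
have line i z u v : (forall j, T j (z j)) -> T i u -> T i v ->
    f (upd z i u) * g (upd z i v) - g (upd z i u) * f (upd z i v) != 0 ->
    forall al be : K, exists z, (forall i, T i (z i)) /\ f z = al /\ g z = be.
  move=> Tz Tu Tv D al be; have [s [t [Es Et]]] := cramer2 al be D.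
  exists (upd z i (s *: u + t *: v)); split; last by rewrite fl gl.
  by apply: T_upd => //; apply: (Tl i).2.
elim: r x y => [|i r IH] x y Tx Ty xy D.
  have xy1 : x =1 y by move=> j; apply: xy.
  by move: D; rewrite (fe _ _ xy1) (ge _ _ xy1) mulrC subrr eqxx.
have Tx' : forall j, T j (upd x i (y i) j) by apply: T_upd.
have Ty' : forall j, T j (upd y i (x i) j) by apply: T_upd.
have [D1|] := boolP (f (upd x i (y i)) * g y - g (upd x i (y i)) * f y != 0).
  exact: IH Tx' Ty (agree_off_updl xy) D1.
rewrite negbK => /eqP D1.
have [D2|] := boolP (f x * g (upd y i (x i)) - g x * f (upd y i (x i)) != 0).
  exact: IH Tx Ty' (agree_off_updr xy) D2.
rewrite negbK => /eqP D2.
have [D3|] := boolP (f (upd x i (x i)) * g (upd x i (y i))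
                     - g (upd x i (x i)) * f (upd x i (y i)) != 0).
  exact: line D3.
rewrite negbK => /eqP; rewrite (fe _ _ (upd_id x i)) (ge _ _ (upd_id x i)) => D3.
have [D4|] := boolP (f (upd y i (x i)) * g (upd y i (y i))
                     - g (upd y i (x i)) * f (upd y i (y i)) != 0).
  exact: line D4.
rewrite negbK => /eqP; rewrite (fe _ _ (upd_id y i)) (ge _ _ (upd_id y i)) => D4.
(* A pair [(p, q)] proportional to both independent pairs [(f x, g x)] and [(f y, g y)] is zero. *)
have zero (p q : K) : p * g y - q * f y = 0 -> f x * q - g x * p = 0 ->
    p = 0 /\ q = 0.
  move=> E1 E2.
  have Ep : p * (f x * g y - g x * f y) = 0.
    have -> : p * (f x * g y - g x * f y) =
      f x * (p * g y - q * f y) + f y * (f x * q - g x * p) by ring.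
    by rewrite E1 E2 !mulr0 addr0.
  have Eq : q * (f x * g y - g x * f y) = 0.
    have -> : q * (f x * g y - g x * f y) =
      g x * (p * g y - q * f y) + g y * (f x * q - g x * p) by ring.
    by rewrite E1 E2 !mulr0 addr0.
  move/eqP: Ep; move/eqP: Eq.
  by rewrite !mulf_eq0 (negPf D) !orbF => /eqP -> /eqP ->.
have [fx' gx'] := zero _ _ D1 D3.
have [fy' gy'] := zero _ _ D4 D2.
have sumE (h : (I -> V) -> K^o) z : multilinear h ->
    h (upd z i (x i + y i)) = h (upd z i (x i)) + h (upd z i (y i)).
  by move=> [_ hl]; have := hl z i 1 1 (x i) (y i); rewrite !scale1r.
have Txy : T i (x i + y i).
  by rewrite -[x i]scale1r -[y i]scale1r; apply: (Tl i).2.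
apply: (IH (upd x i (x i + y i)) (upd y i (x i + y i))).
- exact: T_upd.
- exact: T_upd.
- exact: agree_off_upd.
- rewrite !sumE // fx' gx' fy' gy' !addr0 !add0r.
  by rewrite (fe _ _ (upd_id x i)) (ge _ _ (upd_id x i))
             (fe _ _ (upd_id y i)) (ge _ _ (upd_id y i)).
Qed.

(** Coordinates are freed one at a time: with the others fixed, the vectors sent into [S] form a
    subspace containing [B]. That [B] spans is phrased as an induction principle over subspaces. *)
Lemma multilinear_span (K : fieldType) (I : finType) (V W : lmodType K)
    (f : (I -> V) -> W) (B : V -> Prop) (S : W -> Prop) :
  multilinear f ->
  (forall T, lin_closed T -> (forall b, B b -> T b) -> forall v, T v) ->
  lin_closed S -> (forall a, (forall i, B (a i)) -> S (f a)) ->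
  forall a, S (f a).
Proof.
move=> [fe fl] Bspan Sl SB a.
suff H (r : seq I) b : (forall i, i \notin r -> B (b i)) -> S (f b).
  by apply: (H (enum I)) => i; rewrite mem_enum.
elim: r b => [|i r IH] b Bb; first by apply: SB => i; apply: Bb.
rewrite -(fe _ _ (upd_id b i)).
apply: (Bspan (fun v => S (f (upd b i v)))) => [|v Bv].
  split=> [|s t u v Su Sv]; last by rewrite fl; apply: Sl.2.
  by have := fl b i 0 0 0 0; rewrite !scale0r addr0 => ->; rewrite addr0; apply: Sl.1.
apply: IH => j jr; rewrite /upd; case: eqP => // /eqP ji.
by apply: Bb; rewrite inE negb_or ji jr.
Qed.

(** * Multilinearity and equivariance of the evaluation of p *)

Lemma prod_linear_at (K : fieldType) (A : algType K) (J : eqType) (r : seq J)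
    (j0 : J) (F G H : J -> A) (s t : K) :
  uniq r -> j0 \in r -> F j0 = s *: G j0 + t *: H j0 ->
  (forall j, j != j0 -> F j = G j /\ F j = H j) ->
  \prod_(j <- r) F j = s *: \prod_(j <- r) G j + t *: \prod_(j <- r) H j.
Proof.
move=> + + F0 FGH; elim: r => // k r IH /= /andP[kr ur].
rewrite !big_cons inE; case: (j0 =P k) => [E _|/eqP nE /= j0r].
  have eq_tl (G' : J -> A) : (forall j, j != j0 -> F j = G' j) ->
      \prod_(j <- r) F j = \prod_(j <- r) G' j.
    move=> FG; apply: eq_big_seq => j jr; apply: FG.
    by apply: contraNneq kr => E2; rewrite -E -E2.
  rewrite -E F0 mulrDl -!scalerAl; congr (_ *: (_ * _) + _ *: (_ * _)).
    by apply: eq_tl => j /FGH[].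
  by apply: eq_tl => j /FGH[].
rewrite IH // mulrDr -!scalerAr; have [|<- <-//] := FGH k.
by rewrite eq_sym.
Qed.

Lemma mlin_eval_ext (K : fieldType) m (c : {perm 'I_m} -> K) (a b : 'I_m -> 'M_2) :
  a =1 b -> mlin_eval c a = mlin_eval c b.
Proof.
by move=> ab; apply: eq_bigr => s _; congr (_ *: _); apply: eq_bigr => i _; apply: ab.
Qed.

Lemma mlin_eval_multilinear (K : fieldType) m (c : {perm 'I_m} -> K) :
  multilinear (mlin_eval c).
Proof.
split=> [|a i s t u v]; first exact: mlin_eval_ext.
rewrite /mlin_eval !scaler_sumr -big_split /=; apply: eq_bigr => p _.
rewrite !scalerA ![_ * c p]mulrC -!scalerA -scalerDr; congr (_ *: _).
(* The variable [i] occurs in the monomial of [p] exactly once, at position [p^-1 i]. *)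
apply: (@prod_linear_at _ _ _ _ ((p^-1)%g i)); rewrite ?index_enum_uniq ?mem_index_enum //.
  by rewrite /upd !permKV eqxx.
move=> j ji; rewrite /upd; case: eqP => // E.
by move: ji; rewrite -E permK eqxx.
Qed.

Lemma multilinear_entry (K : fieldType) m (c : {perm 'I_m} -> K) i j :
  multilinear (fun a => mlin_eval c a i j : K^o).
Proof.
have [e l] := mlin_eval_multilinear c.
split=> [a b ab|a k s t u v]; first by rewrite (e _ _ ab).
by rewrite l !mxE.
Qed.

Lemma mlin_eval_morph (K : fieldType) m (c : {perm 'I_m} -> K)
    (h : 'M[K]_2 -> 'M[K]_2) (a : 'I_m -> 'M_2) :
  h 0 = 0 -> {morph h : A B / A + B} -> (forall k, {morph h : A / k *: A}) ->
  h 1 = 1 -> {morph h : A B / A * B} ->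
  mlin_eval c (h \o a) = h (mlin_eval c a).
Proof.
move=> h0 hD hZ h1 hM; rewrite /mlin_eval (big_morph h hD h0).
by apply: eq_bigr => s _; rewrite hZ (big_morph h hM h1).
Qed.

Lemma mlin_imageZ (K : fieldType) m (c : {perm 'I_m} -> K) k A :
  (0 < m)%N -> mlin_image c A -> mlin_image c (k *: A).
Proof.
case: m c => // m c _ [a <-]; have [e l] := mlin_eval_multilinear c.
exists (upd a ord0 (k *: a ord0)).
have := l a ord0 k 0 (a ord0) 0; rewrite !scale0r !addr0 => ->.
by rewrite (e _ _ (upd_id a ord0)).
Qed.

(** * Two by two matrices *)

Lemma ord2P (i : 'I_2) : i = 0 \/ i = 1.
Proof. by case: i => [[|[|//]] p]; [left|right]; apply: val_inj. Qed.

Lemma sum2 (V : nmodType) (F : 'I_2 -> V) : \sum_i F i = F 0 + F 1.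
Proof.
rewrite !big_ord_recl big_ord0 addr0; congr (F _ + F _); exact: val_inj.
Qed.

Lemma mx2P (K : Type) (A B : 'M[K]_2) :
  A 0 0 = B 0 0 -> A 0 1 = B 0 1 -> A 1 0 = B 1 0 -> A 1 1 = B 1 1 -> A = B.
Proof. by move=> ????; apply/matrixP => i j; case: (ord2P i) => ->; case: (ord2P j) => ->. Qed.

Lemma mulmx2E (K : fieldType) (A B : 'M[K]_2) i j :
  (A * B) i j = A i 0 * B 0 j + A i 1 * B 1 j.
Proof. by rewrite mxE sum2. Qed.

Lemma mxtrace2 (K : fieldType) (A : 'M[K]_2) : \tr A = A 0 0 + A 1 1.
Proof. by rewrite /mxtrace sum2. Qed.

Lemma det2 (K : fieldType) (A : 'M[K]_2) : \det A = A 0 0 * A 1 1 - A 0 1 * A 1 0.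
Proof.
rewrite (expand_det_row _ 0) sum2 /cofactor !det_mx11 !mxE /= expr0 expr1.
have -> : lift 0 0 = 1 :> 'I_2 by apply: val_inj.
have -> : lift 1 0 = 0 :> 'I_2 by apply: val_inj.
by ring.
Qed.

Lemma unit2 (K : fieldType) (A : 'M[K]_2) : (A \is a GRing.unit) = (\det A != 0).
Proof. exact: etrans (unitmxE A) (unitfE _). Qed.

Definition nonscalar (K : fieldType) (A : 'M[K]_2) : bool :=
  [|| A 0 1 != 0, A 1 0 != 0 | A 0 0 != A 1 1].

Lemma nonscalarZ (K : fieldType) k (A : 'M[K]_2) : k != 0 -> nonscalar (k *: A) = nonscalar A.
Proof.
by move=> k0; rewrite /nonscalar !mxE !mulf_eq0 (negPf k0) (inj_eq (mulfI k0)).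
Qed.

Definition mx2 (K : fieldType) (p q r s : K) : 'M[K]_2 :=
  \matrix_(i, j) (if i == 0 then if j == 0 then p else q else if j == 0 then r else s).

Lemma mx2E (K : fieldType) (p q r s : K) :
  (mx2 p q r s 0 0 = p) * (mx2 p q r s 0 1 = q) *
  (mx2 p q r s 1 0 = r) * (mx2 p q r s 1 1 = s).
Proof. by rewrite !mxE. Qed.

Lemma scalar2P (K : fieldType) (A : 'M[K]_2) : ~~ nonscalar A -> A = (A 0 0)%:M.
Proof.
rewrite /nonscalar !negb_or !negbK => /and3P[/eqP a /eqP b /eqP d].
by apply: mx2P; rewrite !mxE.
Qed.

(* A nonscalar A has a vector v with v, vA independent; the rows of g. *)
Lemma nonscalar_companion (K : fieldType) (A : 'M[K]_2) : nonscalar A ->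
  exists2 g, g \is a GRing.unit & g * A = mx2 0 1 (- \det A) (\tr A) * g.
Proof.
have key v0 v1 : v0 * (v0 * A 0 1 + v1 * A 1 1) - v1 * (v0 * A 0 0 + v1 * A 1 0) != 0 ->
    exists2 g, g \is a GRing.unit & g * A = mx2 0 1 (- \det A) (\tr A) * g.
  move=> D; exists (mx2 v0 v1 (v0 * A 0 0 + v1 * A 1 0) (v0 * A 0 1 + v1 * A 1 1)).
    by rewrite unit2 det2 !mx2E.
  by apply: mx2P; rewrite !mulmx2E !mx2E ?det2 ?mxtrace2; ring.
(* The vectors (1,0), (0,1), (1,1) are tried in turn; if all three are eigenvectors, [A] is
   scalar. *)
have [a01 _|/negPn/eqP a01] := boolP (A 0 1 != 0).
  by apply: (key 1 0); rewrite !(mul1r, mul0r, subr0, addr0).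
have [a10 _|/negPn/eqP a10] := boolP (A 1 0 != 0).
  by apply: (key 0 1); rewrite !(mul1r, mul0r, add0r, sub0r) oppr_eq0.
rewrite /nonscalar a01 a10 eqxx /= => d.
by apply: (key 1 1); rewrite a01 a10 !(mul1r, add0r, addr0) subr_eq0 eq_sym.
Qed.

Lemma mlin_image_conj (K : fieldType) m (c : {perm 'I_m} -> K) (g A : 'M[K]_2) :
  g \is a GRing.unit -> mlin_image c A -> mlin_image c (g * A / g).
Proof.
move=> gu [a <-]; exists ((fun B => g * B / g) \o a).
apply: (mlin_eval_morph c (h := fun B => g * B / g)).
- by rewrite mulr0 mul0r.
- by move=> A1 B1; rewrite mulrDr mulrDl.
- by move=> k A1; rewrite -scalerAr -scalerAl.
- by rewrite mulr1 divrr.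
- by move=> A1 B1; rewrite !mulrA divrK.
Qed.

(** Both matrices are conjugate to the companion matrix of their common characteristic
    polynomial. *)
Lemma mlin_image_sim (K : fieldType) m (c : {perm 'I_m} -> K) (A B : 'M[K]_2) :
  nonscalar A -> nonscalar B -> \tr A = \tr B -> \det A = \det B ->
  mlin_image c A -> mlin_image c B.
Proof.
move=> nA nB tE dE iA.
have [g gu gE] := nonscalar_companion nA; have [h hu hE] := nonscalar_companion nB.
have -> : B = h^-1 * (g * A / g) / h^-1.
  by rewrite gE tE dE mulrK // invrK -mulrA -hE mulKr.
by apply: mlin_image_conj; rewrite ?unitrV //; apply: mlin_image_conj.
Qed.

(** * Matrix units and gradings *)

Lemma unit_span (K : fieldType) (T : 'M[K]_2 -> Prop) : lin_closed T ->
  (forall B, (exists u : 'I_2 * 'I_2, B = delta_mx u.1 u.2) -> T B) -> forall A, T A.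
Proof.
move=> Tl TB A; rewrite [A]matrix_sum_delta.
apply: (lin_closed_sum _ _ Tl) => i; apply: (lin_closed_sum _ _ Tl) => j.
by apply: (lin_closedZ _ Tl); apply: TB; exists (i, j).
Qed.

Definition units (K : fieldType) m (u : {ffun 'I_m -> 'I_2 * 'I_2}) (i : 'I_m) : 'M[K]_2 :=
  delta_mx (u i).1 (u i).2.

(** Tuples of matrix units form a finite type, so a search decides whether one of them leaves the
    subspace [S]; if none does, multilinearity extends this to all tuples. *)
Lemma mlin_eval_units (K : fieldType) m (c : {perm 'I_m} -> K) (S : pred 'M[K]_2) :
  lin_closed S ->
  (exists u, ~~ S (mlin_eval c (units K u))) \/ (forall a, S (mlin_eval c a)).
Proof.
move=> Sl; have [/existsP H|] :=
  boolP [exists u : {ffun 'I_m -> 'I_2 * 'I_2}, ~~ S (mlin_eval c (units K u))]; [by left|].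
rewrite negb_exists => /forallP H; right.
apply: (multilinear_span (mlin_eval_multilinear c) (@unit_span K) Sl) => a Ba.
have Bb i : exists u : 'I_2 * 'I_2, a i == delta_mx u.1 u.2.
  by have [u ->] := Ba i; exists u.
have -> : mlin_eval c a = mlin_eval c (units K [ffun i => xchoose (Bb i)]).
  by apply: mlin_eval_ext => i; rewrite /units ffunE; apply/eqP; apply: (xchooseP (Bb i)).
by have := H [ffun i => xchoose (Bb i)]; rewrite negbK.
Qed.

(* [e] is the degree of the matrix unit e_01: a grading of M_2(K) by G. *)
Definition homog (K : fieldType) (G : zmodType) (e k : G) (A : 'M[K]_2) : Prop :=
  forall i j, A i j != 0 -> e *+ j - e *+ i = k.

Lemma homog_lin_closed (K : fieldType) (G : zmodType) (e k : G) :
  lin_closed (@homog K G e k).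
Proof.
split=> [i j|s t u v Hu Hv i j]; first by rewrite mxE eqxx.
rewrite !mxE; have [u0|/Hu//] := eqVneq (u i j) 0.
have [v0|/Hv//] := eqVneq (v i j) 0.
by rewrite u0 v0 !mulr0 addr0 eqxx.
Qed.

Lemma homog_mul (K : fieldType) (G : zmodType) (e k l : G) (A B : 'M[K]_2) :
  homog e k A -> homog e l B -> homog e (k + l) (A * B).
Proof.
move=> HA HB i j; rewrite mxE => /negP H.
have [/existsP[h /andP[/HA Eh /HB Eh']]|] := boolP [exists h, (A i h != 0) && (B h j != 0)].
  by rewrite -Eh -Eh' [RHS]addrC addrA subrK.
rewrite negb_exists => /forallP N; case: H; rewrite big1 // => h _; apply/eqP.
by have := N h; rewrite negb_and !negbK mulf_eq0.
Qed.

(** Every monomial uses each argument exactly once, so all monomials have the same total degree. *)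
Lemma homog_mlin_eval (K : fieldType) (G : zmodType) (e : G) m (c : {perm 'I_m} -> K)
    (k : 'I_m -> G) (a : 'I_m -> 'M[K]_2) :
  (forall i, homog e (k i) (a i)) -> homog e (\sum_i k i) (mlin_eval c a).
Proof.
move=> Ha; have Hl := homog_lin_closed K e (\sum_i k i).
apply: (lin_closed_sum _ _ Hl) => s; apply: (lin_closedZ _ Hl).
rewrite (reindex_inj (@perm_inj _ s)) /=.
apply: (big_ind2 (fun l A => homog e l A)) => [i j|*|i _]; last exact: Ha.
  by rewrite mxE; case: (i =P j) => [->|]; rewrite ?subrr ?eqxx.
exact: homog_mul.
Qed.

Lemma homog_units (K : fieldType) (G : zmodType) (e : G) m (u : {ffun 'I_m -> 'I_2 * 'I_2}) i :
  homog e (e *+ (u i).2 - e *+ (u i).1) (units K u i).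
Proof.
move=> p q; rewrite mxE; case: (p =P _) => [->|_] /=; last by rewrite eqxx.
by case: (q =P _) => [->|_]; rewrite ?eqxx.
Qed.

(** Conjugation by the permutation matrix that exchanges the two basis vectors. *)
Definition swap2 (K : fieldType) (A : 'M[K]_2) : 'M[K]_2 :=
  mx2 (A 1 1) (A 1 0) (A 0 1) (A 0 0).

Lemma swap2_mlin_eval (K : fieldType) m (c : {perm 'I_m} -> K) (a : 'I_m -> 'M[K]_2) :
  mlin_eval c (@swap2 K \o a) = swap2 (mlin_eval c a).
Proof.
apply: mlin_eval_morph => [|A B|k A||A B]; apply: mx2P;
  rewrite ?mulmx2E ?mx2E ?mulmx2E ?[LHS]mxE ?[RHS]mxE ?mx2E //; exact: addrC.
Qed.

Lemma swap2E (K : fieldType) (A : 'M[K]_2) i j : swap2 A i j = A (1 - i) (1 - j).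
Proof.
by case: (ord2P i) => ->; case: (ord2P j) => ->; rewrite mx2E ?subr0 ?subrr.
Qed.

(** Exchanging the indices negates degrees, and in ['I_2], that is Z/2, a degree equals its
    negative. *)
Lemma swap2_homog (K : fieldType) (k : 'I_2) (A : 'M[K]_2) :
  homog (1 : 'I_2) k A -> homog (1 : 'I_2) k (swap2 A).
Proof.
move=> H i j; rewrite swap2E => /H <-.
by case: (ord2P i) => ->; case: (ord2P j) => ->; apply/eqP.
Qed.

(* The second independent value comes from exchanging the indices 0 and 1 in every
   argument; this keeps parities. *)
Lemma units_pair_surj (K : fieldType) m (c : {perm 'I_m} -> K) u (i j : 'I_2) :
  mlin_eval c (units K u) i j ^+ 2 != mlin_eval c (units K u) (1 - i) (1 - j) ^+ 2 ->
  forall al be, exists z, mlin_eval c z i j = al /\ mlin_eval c z (1 - i) (1 - j) = be /\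
    homog (1 : 'I_2) (1 *+ j - 1 *+ i) (mlin_eval c z).
Proof.
set A := mlin_eval c _ => D al be.
pose k l : 'I_2 := 1 *+ (u l).2 - 1 *+ (u l).1.
have HA : homog (1 : 'I_2) (\sum_l k l) A.
  by apply: homog_mlin_eval => l; apply: homog_units.
(* The squares differ, so one of the two entries is nonzero, and either one determines the parity of
   the value. *)
have Ek : \sum_l k l = 1 *+ j - 1 *+ i.
  have [Aij|/HA//] := eqVneq (A i j) 0.
  have [Aij'|/(swap2_homog HA)//] := eqVneq (swap2 A i j) 0.
  by move: D; rewrite Aij -swap2E Aij' eqxx.
have [|||||||z [Tz [<- <-]]] := @multilinear_pair_surj K _ _
  (fun a => mlin_eval c a i j) (fun a => mlin_eval c a (1 - i) (1 - j))
  (fun l => homog (1 : 'I_2) (k l)) (enum 'I_m) (units K u) (@swap2 K \o units K u)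
  _ _ _ _ _ _ _ al be; try exact: multilinear_entry.
- by move=> l; apply: homog_lin_closed.
- by move=> l; apply: homog_units.
- by move=> l; apply/swap2_homog/homog_units.
- by move=> l; rewrite mem_enum.
(* The swapped tuple exchanges the two entries, so the determinant is the difference of their
   squares. *)
- by rewrite swap2_mlin_eval !swap2E !subKr -!expr2 subr_eq0.
by exists z; rewrite -Ek; do 2!split=> //; apply: homog_mlin_eval.
Qed.

(** * The image over an arbitrary field *)

Lemma image_antidiag (K : fieldType) m (c : {perm 'I_m} -> K) u :
  (mlin_eval c (units K u) 0 1 != 0) || (mlin_eval c (units K u) 1 0 != 0) ->
  forall al be, mlin_image c (mx2 0 al be 0).
Proof.
move=> H al be; have Hi := @homog_mlin_eval K int 1 m c _ _ (@homog_units K int 1 m u).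
have [|z [z01 [z10 Hz]]] := @units_pair_surj K m c u 0 1 _ al be.
(* In the integer grading e_01 and e_10 have degrees 1 and -1, so exactly one antidiagonal entry is
   nonzero and the squares differ. *)
- rewrite subr0 subrr.
  have [A01|A01] := eqVneq (mlin_eval c (units K u) 0 1) 0.
    by move: H; rewrite A01 eqxx orFb => A10; rewrite expr0n eq_sym sqrf_eq0.
  have [->|/Hi E] := eqVneq (mlin_eval c (units K u) 1 0) 0.
    by rewrite expr0n sqrf_eq0.
  by have := Hi _ _ A01; rewrite -E.
rewrite subr0 subrr in z10.
(* The value is odd, hence its diagonal vanishes. *)
exists z; apply: mx2P; rewrite ?mx2E //; apply/eqP.
  by have [//|/Hz] := eqVneq (mlin_eval c z 0 0) 0.
by have [//|/Hz] := eqVneq (mlin_eval c z 1 1) 0.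
Qed.

Lemma image_diag (K : fieldType) m (c : {perm 'I_m} -> K) u :
  mlin_eval c (units K u) 0 0 ^+ 2 != mlin_eval c (units K u) 1 1 ^+ 2 ->
  forall al be, mlin_image c (mx2 al 0 0 be).
Proof.
move=> H al be.
have [|z [z00 [z11 Hz]]] := @units_pair_surj K m c u 0 0 _ al be; first by rewrite subr0.
rewrite subr0 in z11.
exists z; apply: mx2P; rewrite ?mx2E //; apply/eqP.
  by have [//|/Hz] := eqVneq (mlin_eval c z 0 1) 0.
by have [//|/Hz] := eqVneq (mlin_eval c z 1 0) 0.
Qed.

Lemma scalar_values_or_antidiag (K : fieldType) m (c : {perm 'I_m} -> K) :
  (forall a, ~~ nonscalar (mlin_eval c a)) \/
  (exists u, (mlin_eval c (units K u) 0 1 != 0) || (mlin_eval c (units K u) 1 0 != 0)).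
Proof.
have [|[u Hu]|H] := @mlin_eval_units K m c (fun A => (A 0 1 == 0) && (A 1 0 == 0)).
- split=> [|s t u v /andP[/eqP u01 /eqP u10] /andP[/eqP v01 /eqP v10]].
    by rewrite !mxE eqxx.
  by rewrite !mxE u01 u10 v01 v10 !mulr0 addr0 eqxx.
- by right; exists u; rewrite -negb_and.
left=> a; have /andP[/eqP A01 /eqP A10] := H a.
(* The conjugate of a diagonal value by this transvection is again a value, hence diagonal, which
   forces equal diagonal entries. *)
pose g : 'M[K]_2 := mx2 1 1 0 1.
have gu : g \is a GRing.unit by rewrite unit2 det2 !mx2E mulr1 mulr0 subr0 oner_eq0.
have [b Eb] : mlin_image c (g * mlin_eval c a / g).
  by apply: mlin_image_conj => //; exists a.
have /andP[/eqP B01 /eqP B10] := H b.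
have E : mlin_eval c b * g = g * mlin_eval c a by rewrite Eb divrK.
have := congr1 (fun M : 'M_2 => M 0 0) E; have := congr1 (fun M : 'M_2 => M 0 1) E.
rewrite /= !mulmx2E !mx2E A01 A10 B01 !(mulr1, mul1r, mulr0, mul0r, addr0, add0r) => -> A11.
by rewrite /nonscalar A01 A10 A11 !eqxx.
Qed.

Lemma image_of_scalar_values (K : fieldType) m (c : {perm 'I_m} -> K) : (0 < m)%N ->
  (forall a, ~~ nonscalar (mlin_eval c a)) ->
  (forall A : 'M[K]_2, mlin_image c A <-> A = 0) \/
  (forall A : 'M[K]_2, mlin_image c A <-> exists k : K, A = k%:M).
Proof.
move=> m0 H; have [|[u Hu]|H0] := @mlin_eval_units K m c (pred1 0).
- by split=> [|s t u v /eqP -> /eqP ->] /=; rewrite ?scaler0 ?addr0 eqxx.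
- right=> A; split=> [[a <-]|[k ->]].
    by exists (mlin_eval c a 0 0); apply: scalar2P.
  set B := mlin_eval _ _ in Hu; have EB : B = (B 0 0)%:M := scalar2P (H _).
  have B0 : B 0 0 != 0.
    by apply: contraNneq Hu => B0; apply/eqP; rewrite EB B0 raddf0.
  have -> : k%:M = (k / B 0 0) *: B by rewrite {2}EB scale_scalar_mx divfK.
  by apply: mlin_imageZ => //; exists (units K u).
left=> A; split=> [[a <-]|->]; first exact/eqP/H0.
by exists (fun=> 0); apply/eqP/H0.
Qed.

Lemma image_nonscalar_tr0 (K : fieldType) m (c : {perm 'I_m} -> K) A :
  (forall al be, mlin_image c (mx2 0 al be 0)) ->
  nonscalar A -> \tr A = 0 -> mlin_image c A.
Proof.
move=> Hc nA trA; apply: (mlin_image_sim _ nA _ _ (Hc 1 (- \det A))).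
- by rewrite /nonscalar !mx2E oner_eq0.
- by rewrite trA mxtrace2 !mx2E addr0.
- by rewrite det2 !mx2E mul1r mulr0 sub0r opprK.
Qed.

(** If the diagonal entries have different squares, every diagonal matrix is a value. If they are
    equal, the integer grading makes [A] a nonzero scalar matrix, and scaling suffices. *)
Lemma image_scalar (K : fieldType) m (c : {perm 'I_m} -> K) u k : (0 < m)%N ->
  let A := mlin_eval c (units K u) in
  (A 0 0 != 0) || (A 1 1 != 0) -> (A 0 0 == A 1 1) || (A 0 0 != - A 1 1) ->
  mlin_image c k%:M.
Proof.
move=> m0 A A0 A1.
have [E|NE] := eqVneq (A 0 0) (A 1 1); last first.
  have -> : k%:M = mx2 k 0 0 k by apply: mx2P; rewrite !mxE.
  apply: (@image_diag _ _ _ u); rewrite -/A eqf_sqr negb_or NE /=.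
  by move: A1; rewrite (negPf NE).
have Hi := @homog_mlin_eval K int 1 m c _ _ (@homog_units K int 1 m u).
have A00 : A 0 0 != 0 by move: A0; rewrite -E orbb.
have EA : A = (A 0 0)%:M.
  apply: mx2P; rewrite ?mxE //=; apply/eqP.
    by have [//|/Hi] := eqVneq (A 0 1) 0; rewrite -(Hi _ _ A00).
  by have [//|/Hi] := eqVneq (A 1 0) 0; rewrite -(Hi _ _ A00).
have -> : k%:M = (k / A 0 0) *: A by rewrite {2}EA scale_scalar_mx divfK.
by apply: mlin_imageZ => //; exists (units K u).
Qed.

Lemma image_sl2 (K : fieldType) m (c : {perm 'I_m} -> K) : (0 < m)%N ->
  (forall al be, mlin_image c (mx2 0 al be 0)) ->
  forall A, \tr A = 0 -> mlin_image c A.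
Proof.
move=> m0 Hc A trA; have [nA|/scalar2P EA] := boolP (nonscalar A).
  exact: image_nonscalar_tr0.
have [A0|A0] := eqVneq (A 0 0) 0.
  have -> // : A = mx2 0 0 0 0.
  by rewrite EA A0; apply: mx2P; rewrite !mxE.
(* A nonzero scalar matrix has trace zero only in characteristic 2. *)
have ch2 (k : K) : k = - k.
  apply/eqP; rewrite -subr_eq0 opprK; apply/eqP.
  apply: (mulfI A0); rewrite mulr0 -[RHS](mulr0 k) -[in RHS]trA mxtrace2 EA !mxE /=.
  by ring.
have [|[u Hu]|H] := @mlin_eval_units K m c (fun A => (A 0 0 == 0) && (A 1 1 == 0)).
- split=> [|s t u v /andP[/eqP u00 /eqP u11] /andP[/eqP v00 /eqP v11]].
    by rewrite !mxE eqxx.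
  by rewrite !mxE u00 u11 v00 v11 !mulr0 addr0 eqxx.
- rewrite EA; apply: (@image_scalar _ _ _ u) => //; first by rewrite -negb_and.
  by rewrite -ch2 orbN.
(* In characteristic 2 the all-ones matrix is nonscalar of trace zero, hence a value, so the values
   cannot all have zero diagonal. *)
have [||a Ea] := @image_nonscalar_tr0 K m c (mx2 1 1 1 1) Hc.
- by rewrite /nonscalar !mx2E oner_eq0.
- by rewrite mxtrace2 !mx2E {1}[1]ch2 addNr.
by have := H a; rewrite Ea !mx2E oner_eq0.
Qed.

(** * Real closed fields *)

(** Of a quadratic form only its expansion along a line is kept; the coefficient of [s] is the polar
    form. *)
Definition quadratic (K : fieldType) (V : lmodType K) (F : V -> K) : Prop :=
  forall A B s, F (A + s *: B) = F A + s * (F (A + B) - F A - F B) + s ^+ 2 * F B.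

Lemma mlin_eval_upd (K : fieldType) m (c : {perm 'I_m} -> K) a i u v s :
  mlin_eval c (upd a i (u + s *: v)) =
  mlin_eval c (upd a i u) + s *: mlin_eval c (upd a i v).
Proof.
have [_ l] := mlin_eval_multilinear c.
by have := l a i 1 s u v; rewrite !scale1r.
Qed.

(** For small positive [s] the constant term dominates, and [u + s * v] has a single root, so [s0]
    or [s0 / 2] works. *)
Lemma small_perturbation (R : realFieldType) (al be ga u v : R) : 0 < al -> v != 0 ->
  exists s, 0 < al + s * be + s ^+ 2 * ga /\ u + s * v != 0.
Proof.
move=> al0 v0; pose w := `|be| + `|ga|; have w0 : 0 <= w by rewrite addr_ge0.
(* Chosen so that [0 < s <= s0] gives [s <= 1] and [s * w <= al / 2]. *)
pose s0 := al / (2 * (al + w)); have aw : 0 < 2 * (al + w) by lra.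
have s0_gt0 : 0 < s0 by rewrite divr_gt0.
have E : s0 * (2 * (al + w)) = al by rewrite divfK ?gt_eqF.
have small s : 0 < s -> s <= s0 -> 0 < al + s * be + s ^+ 2 * ga.
  move=> sp ss0; have s1 : s <= 1 by nra.
  have sw : s * w <= al / 2 by nra.
  have hb : - `|be| <= be by rewrite lerNl -normrN ler_norm.
  have hg : - `|ga| <= ga by rewrite lerNl -normrN ler_norm.
  have h1 : - (s * `|be|) <= s * be by rewrite -mulrN ler_pM2l.
  have h2 : - (s * `|ga|) <= s ^+ 2 * ga.
    apply: (@le_trans _ _ (- (s ^+ 2 * `|ga|))).
      by rewrite lerN2 ler_wpM2r // expr2 ler_piMl // ltW.
    by rewrite -mulrN ler_wpM2l // exprn_ge0 // ltW.
  rewrite /w mulrDr in sw; lra.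
have [H|H] := eqVneq (u + s0 * v) 0; last by exists s0; split=> //; apply: small.
exists (s0 / 2); split; first by apply: small; lra.
have -> : u + s0 / 2 * v = - (s0 / 2 * v).
  by apply/eqP; rewrite -subr_eq0 -[0]H; apply/eqP; field.
by rewrite oppr_eq0 !mulf_neq0 ?invr_eq0 ?pnatr_eq0 // lt0r_neq0.
Qed.

(** Both tuples receive the common entry [x i + s *: y i]: for small [s] the form stays positive at
    the first, and the trace at the second is affine in [s] with nonzero slope. *)
Lemma positive_value_with_trace (R : realFieldType) m (c : {perm 'I_m} -> R)
    (F : 'M[R]_2 -> R) (r : seq 'I_m) x y :
  quadratic F -> agree_off r x y ->
  0 < F (mlin_eval c x) -> \tr (mlin_eval c y) != 0 ->
  exists z, 0 < F (mlin_eval c z) /\ \tr (mlin_eval c z) != 0.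
Proof.
move=> Fq; elim: r x y => [|i r IH] x y xy Fx ty.
  have E : mlin_eval c x = mlin_eval c y by apply: mlin_eval_ext => i; apply: xy.
  by exists x; rewrite {2}E.
set B := mlin_eval c (upd x i (y i)); set C := mlin_eval c (upd y i (x i)).
have [s [Hs ts]] := small_perturbation (F (mlin_eval c x + B) - F (mlin_eval c x) - F B)
  (F B) (\tr C) Fx ty.
apply: (IH _ _ (agree_off_upd (x i + s *: y i) xy)).
  by rewrite mlin_eval_upd (mlin_eval_ext c (upd_id x i)) Fq.
by rewrite mlin_eval_upd (mlin_eval_ext c (upd_id y i)) mxtraceD mxtraceZ.
Qed.

Definition quad_poly (R : nzRingType) (a b d : R) : {poly R} :=
  a%:P + b *: 'X + d *: 'X^2.

Lemma horner_quad_poly (R : comNzRingType) (a b d s : R) :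
  (quad_poly a b d).[s] = a + s * b + s ^+ 2 * d.
Proof. by rewrite /quad_poly !hornerD !hornerZ hornerXn hornerX hornerC mulrC [d * _]mulrC. Qed.

Lemma quad_poly_neq0 (R : nzRingType) (a b d : R) :
  [|| a != 0, b != 0 | d != 0] -> quad_poly a b d != 0.
Proof.
apply: contraTneq => E.
have cE i : (quad_poly a b d)`_i = 0 by rewrite E coef0.
have := (cE 0, cE 1, cE 2); rewrite /quad_poly !coefD !coefC !coefZ !coefX !coefXn /=.
by rewrite !(mulr0, mulr1, addr0, add0r) => -[[-> ->] ->]; rewrite eqxx.
Qed.

Lemma poly_nonroot (R : numFieldType) (p : {poly R}) : p != 0 -> exists s, p.[s] != 0.
Proof.
move=> p0; pose rs : seq R := [seq i%:R | i <- iota 0 (size p)].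
have urs : uniq rs by rewrite map_inj_uniq ?iota_uniq //; apply: (mulrIn (oner_neq0 R)).
have [H|/allPn[s _ ps]] := boolP (all (root p) rs); last by exists s.
by have := max_poly_roots p0 H urs; rewrite size_map size_iota ltnn.
Qed.

(** Coordinate [i] of both tuples is moved to a common generic [w]. Either the sign changes during
    one of the two moves, or the moved tuples keep their signs and differ in fewer coordinates. *)
Lemma sign_change_along_coordinate (R : realFieldType) m (c : {perm 'I_m} -> R)
    (F : 'M[R]_2 -> R) (r : seq 'I_m) x y :
  quadratic F -> agree_off r x y ->
  F (mlin_eval c x) < 0 -> \tr (mlin_eval c x) != 0 ->
  0 < F (mlin_eval c y) -> \tr (mlin_eval c y) != 0 ->
  exists M N, [/\ F M < 0, \tr M != 0, 0 < F N, \tr N != 0 &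
                  forall s t, mlin_image c (s *: M + t *: N)].
Proof.
move=> Fq; elim: r x y => [|i r IH] x y xy Fx tx Fy ty.
  have E : mlin_eval c x = mlin_eval c y by apply: mlin_eval_ext => i; apply: xy.
  by have := lt_trans Fx Fy; rewrite E ltxx.
have [_ l] := mlin_eval_multilinear c.
have line a u v s t :
    mlin_image c (s *: mlin_eval c (upd a i u) + t *: mlin_eval c (upd a i v)).
  by exists (upd a i (s *: u + t *: v)).
set A := mlin_eval c x; set D := mlin_eval c y.
set B := mlin_eval c (upd x i (y i)); set C := mlin_eval c (upd y i (x i)).
pose q1 := quad_poly (F A) (F (A + B) - F A - F B) (F B).
pose q2 := quad_poly (F C) (F (C + D) - F C - F D) (F D).
pose q3 := quad_poly (\tr A) (\tr B) 0; pose q4 := quad_poly (\tr C) (\tr D) 0.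
(* A non-root of the product keeps form and trace nonzero at both moved tuples. The factors are
   nonzero by their coefficients from [A] (constant) or [D] (top). *)
have [|s] := @poly_nonroot _ (q1 * q2 * q3 * q4).
  by rewrite !mulf_neq0 // quad_poly_neq0 ?tx ?ty ?orbT // ?(lt_eqF Fx) ?(gt_eqF Fy) ?orbT.
rewrite !hornerM !horner_quad_poly -!Fq !mulr0 !addr0 -!mxtraceZ -!mxtraceD.
rewrite !mulf_eq0 !negb_or -!andbA => /and4P[F1 F2 t1 t2].
pose w := x i + s *: y i.
have E1 : mlin_eval c (upd x i w) = A + s *: B.
  by rewrite mlin_eval_upd (mlin_eval_ext c (upd_id x i)).
have E2 : mlin_eval c (upd y i w) = C + s *: D.
  by rewrite mlin_eval_upd (mlin_eval_ext c (upd_id y i)).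
have [F1p|F1n|F10] := ltgtP 0 (F (A + s *: B)); last by rewrite -F10 eqxx in F1.
  exists A, (A + s *: B); split=> // k t.
  by rewrite -E1 /A -(mlin_eval_ext c (upd_id x i)).
have [F2p|F2n|F20] := ltgtP 0 (F (C + s *: D)); last by rewrite -F20 eqxx in F2.
  by apply: (IH _ _ (agree_off_upd w xy)); rewrite ?E1 ?E2.
exists (C + s *: D), D; split=> // k t.
by rewrite -E2 /D -(mlin_eval_ext c (upd_id y i)).
Qed.

(** At nonzero trace it vanishes exactly when det / tr^2 = [th], a ratio invariant under scaling.
    For [th] = 1/4 it is -1/4 times the discriminant of the characteristic polynomial. *)
Definition disc_form (K : fieldType) (th : K) (A : 'M[K]_2) : K :=
  \det A - th * \tr A ^+ 2.

Lemma disc_form_quadratic (K : fieldType) (th : K) : quadratic (disc_form th).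
Proof. by move=> A B s; rewrite /disc_form !det2 !mxtrace2 !mxE; ring. Qed.

Lemma disc_formN (K : fieldType) (th : K) A : disc_form th (- A) = disc_form th A.
Proof. by rewrite /disc_form !det2 !mxtrace2 !mxE; ring. Qed.

(* For th <> 1/4 no scalar matrix with nonzero trace is a zero.  For th = 1/4 the
   form only depends on A modulo scalars, so M and N would be proportional modulo
   scalars if a combination of them were scalar, contradicting the signs. *)
Lemma disc_form_zero (R : rcfType) (th : R) (M N : 'M[R]_2) :
  disc_form th M < 0 -> \tr M != 0 -> 0 < disc_form th N -> \tr N != 0 ->
  exists s t, let P := s *: M + t *: N in
    [/\ disc_form th P = 0, \tr P != 0 & nonscalar P].
Proof.
(* Replacing [N] by [- N] gives the traces equal signs, so the trace has no zero on the segment from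
   [M] to [N]. *)
wlog tMN : N / 0 < \tr M * \tr N.
  move=> H FM tM FN tN; have [p|n|e] := ltgtP 0 (\tr M * \tr N); first exact: H.
    have [||||| s [t Hst]] := H (- N); rewrite ?disc_formN ?raddfN ?oppr_eq0 ?mulrN ?oppr_gt0 //.
    by exists s, (- t); rewrite scaleNr -scalerN.
  by move/eqP: e; rewrite eq_sym mulf_eq0 (negPf tM) (negPf tN).
move=> FM tM FN tN.
pose q := quad_poly (disc_form th M)
  (disc_form th (M + (N - M)) - disc_form th M - disc_form th (N - M)) (disc_form th (N - M)).
have qE s : q.[s] = disc_form th (M + s *: (N - M)).
  by rewrite horner_quad_poly disc_form_quadratic.
have [||s /andP[s0 s1] /rootP] := @poly_ivt R q 0 1; first exact: ler01.
  by rewrite !qE scale0r addr0 scale1r addrC subrK !ltW.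
rewrite qE => qs; exists (1 - s), s => P.
have EP : M + s *: (N - M) = P.
  by rewrite /P scalerBr scalerBl scale1r addrA addrAC.
rewrite EP in qs.
have tP : \tr P != 0.
  have E : \tr M * \tr P = (1 - s) * \tr M ^+ 2 + s * (\tr M * \tr N).
    by rewrite /P mxtraceD !mxtraceZ; ring.
  have tM2 : 0 < \tr M ^+ 2 by rewrite lt0r sqrf_eq0 tM sqr_ge0.
  have : 0 < \tr M * \tr P.
    rewrite E; have [->|sn] := eqVneq s 0; first by rewrite subr0 mul1r mul0r addr0.
    have sp : 0 < s by rewrite lt0r sn.
    apply: ltr_wpDl; last exact: mulr_gt0.
    by rewrite mulr_ge0 ?subr_ge0 ?(ltW tM2).
  by move=> /lt0r_neq0; rewrite mulf_eq0 negb_or => /andP[].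
split=> //; apply/negPn/negP => nP.
move: (nP); rewrite /nonscalar !negb_or !negbK => /and3P[/eqP P01 /eqP P10 /eqP P00].
have th4 : 4 * th = 1.
  apply/eqP; rewrite -subr_eq0; apply/eqP.
  have P11 : P 1 1 ^+ 2 != 0.
    by rewrite sqrf_eq0; apply: contraNneq tP => P11; rewrite mxtrace2 P00 P11 addr0.
  apply: (mulIf P11); rewrite mul0r -[RHS]oppr0 -[in RHS]qs.
  by rewrite /disc_form det2 mxtrace2 P01 P10 P00; ring.
have F4 A : 4 * disc_form th A = - (A 0 0 - A 1 1) ^+ 2 - 4 * (A 0 1 * A 1 0).
  by rewrite /disc_form mulrBr [4 * (th * _)]mulrA th4 det2 mxtrace2; ring.
have prop (i j : 'I_2) : P i j = (1 - s) * M i j + s * N i j by rewrite !mxE.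
rewrite !prop in P01 P10 P00.
have E01 : s * N 0 1 = - ((1 - s) * M 0 1) by lra.
have E10 : s * N 1 0 = - ((1 - s) * M 1 0) by lra.
have E00 : s * (N 0 0 - N 1 1) = - ((1 - s) * (M 0 0 - M 1 1)) by lra.
have E : s ^+ 2 * (4 * disc_form th N) = (1 - s) ^+ 2 * (4 * disc_form th M).
  rewrite !F4.
  have -> : s ^+ 2 * (- (N 0 0 - N 1 1) ^+ 2 - 4 * (N 0 1 * N 1 0)) =
    - (s * (N 0 0 - N 1 1)) ^+ 2 - 4 * ((s * N 0 1) * (s * N 1 0)) by ring.
  by rewrite E00 E01 E10; ring.
have [sz|sn] := eqVneq s 0.
  by move: E; rewrite sz expr0n mul0r subr0 expr1n mul1r => E; lra.
have s2 : 0 < s ^+ 2 by rewrite lt0r sqrf_eq0 sn sqr_ge0.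
have : 0 < s ^+ 2 * (4 * disc_form th N) by rewrite mulr_gt0 // mulr_gt0.
apply/negP; rewrite E -leNgt mulr_ge0_le0 ?sqr_ge0 //; lra.
Qed.

Lemma image_full (R : rcfType) m (c : {perm 'I_m} -> R) u : (0 < m)%N ->
  (forall al be, mlin_image c (mx2 0 al be 0)) ->
  \tr (mlin_eval c (units R u)) != 0 -> forall A, mlin_image c A.
Proof.
move=> m0 Hc tu A; have [nA|/scalar2P ->] := boolP (nonscalar A); last first.
  apply: (@image_scalar _ _ _ u) => //.
    rewrite -negb_and; apply: contra tu => /andP[/eqP a /eqP b].
    by rewrite mxtrace2 a b addr0.
  by rewrite -addr_eq0 -mxtrace2 tu orbT.
have [tA|tA] := eqVneq (\tr A) 0; first exact: image_nonscalar_tr0.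
pose th := \det A / \tr A ^+ 2.
have off (x y : 'I_m -> 'M[R]_2) : agree_off (enum 'I_m) x y.
  by move=> i; rewrite mem_enum.
have dE k : disc_form th (mx2 0 1 k 0) = - k.
  by rewrite /disc_form det2 mxtrace2 !mx2E addr0 expr0n !mulr0 mul1r sub0r subr0.
(* Trace-zero values at which the form is 1 and -1. *)
have [a Ea] := Hc 1 (-1); have [b Eb] := Hc 1 1.
have [||y [Fy ty]] :=
  @positive_value_with_trace R m c _ _ _ _ (disc_form_quadratic th) (off a (units R u)).
- by rewrite Ea dE opprK.
- exact: tu.
have [|||x [Fx tx]] :=
  @positive_value_with_trace R m c (fun A => - disc_form th A) _ _ _ _ (off b (units R u)).
- by move=> A' B' s; rewrite disc_form_quadratic; ring.
- by rewrite Eb dE opprK.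
- exact: tu.
rewrite oppr_gt0 in Fx.
have [M [N [FM tM FN tN iMN]]] :=
  sign_change_along_coordinate (disc_form_quadratic th) (off x y) Fx tx Fy ty.
have [s [t /= [FP tP nP]]] := disc_form_zero FM tM FN tN.
move: (iMN s t) FP tP nP; move: (s *: M + t *: N) => P iP FP tP nP.
(* Scaled to the trace of [A], the matrix [P] also has its determinant, by the choice of [th], and
   is similar to [A]. *)
have l0 : \tr A / \tr P != 0 by rewrite mulf_neq0 ?invr_eq0.
apply: (mlin_image_sim _ nA _ _ (mlin_imageZ (\tr A / \tr P) m0 iP)).
- by rewrite nonscalarZ.
- by rewrite mxtraceZ divfK.
have dP : \det P = th * \tr P ^+ 2 by apply/eqP; rewrite -subr_eq0 -FP.
by rewrite detZ dP /th; field; rewrite tA tP.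
Qed.

(** The real case is proved over any real closed field. For [m = 0] the image would be a single
    scalar matrix, hence [0 < m]. *)
Theorem theorem1p8 :
  (forall (K : fieldType) (m : nat) (c : {perm 'I_m} -> K), (0 < m)%N ->
     (forall A : 'M[K]_2, mlin_image c A <-> A = 0)
  \/ (forall A : 'M[K]_2, mlin_image c A <-> exists k : K, A = k%:M)
  \/ (forall A : 'M[K]_2, \tr A = 0 -> mlin_image c A))
  /\
  (forall (R : rcfType) (m : nat) (c : {perm 'I_m} -> R), (0 < m)%N ->
     (forall A : 'M[R]_2, mlin_image c A <-> A = 0)
  \/ (forall A : 'M[R]_2, mlin_image c A <-> exists k : R, A = k%:M)
  \/ (forall A : 'M[R]_2, mlin_image c A <-> \tr A = 0)
  \/ (forall A : 'M[R]_2, mlin_image c A)).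
Proof.
split=> K m c m0; have [/(image_of_scalar_values m0)[H|H]|[u Hu]] := scalar_values_or_antidiag c.
- by left.
- by right; left.
- by right; right; apply: image_sl2 => //; apply: image_antidiag Hu.
- by left.
- by right; left.
have Hc := image_antidiag Hu.
right; right.
(* The trace on tuples of matrix units separates the image sl_2 from the full matrix algebra. *)
have [|[v tv]|H] := @mlin_eval_units K m c (fun A => \tr A == 0).
- split=> [|s t A B /eqP tA /eqP tB]; first by rewrite mxtrace0.
  by rewrite mxtraceD !mxtraceZ tA tB !mulr0 addr0.
- by right; apply: image_full tv.
left=> A; split=> [[a <-]|]; last exact: image_sl2.
exact/eqP/H.
Qed.
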